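(* Let $(M,\phi,\xi,\eta,g)$ be a $(2n+1)$-dimensional para-Sasaki-like Riemannian manifold, let $u,v,w$ be smooth functions on $M$, and let $(\phi,\overline\xi,\overline\eta,\overline g)$ be the paracontact conformal transformation of $(\phi,\xi,\eta,g)$ determined by $u,v,w$, i.e. $\overline\eta=\exp(w)\eta$, $\overline\xi=\exp(-w)\xi$, $$\overline g(x,y)=\exp(2u)\cosh(2v)g(x,y)+\exp(2u)\sinh(2v)g(x,\phi y)+\{\exp(2w)-\exp(2u)\cosh(2v)\}\eta(x)\eta(y).$$ Then the structure $(\phi,\overline\xi,\overline\eta,\overline g)$ is para-Sasaki-like if and only if $u,v,w$ satisfy $$dw\circ\phi=0,\qquad du-dv\circ\phi=0,\qquad du\circ\phi-dv=[1-\exp(w)]\eta.$$ Consequently, in that case, $du(\xi)=0$ and $dv(\xi)=\exp(w)-1$. In the case $w=0$, the functions $u$ and $v$ do not depend on $\xi$ (i.e. $du(\xi)=dv(\xi)=0$) and they are locally defined on the paracomplex submanifold $N^{2n}$, $TN^{2n}=H=\ker\eta$; then the paracomplex-valued function $u+e\,v$, where $e^2=1$, is a paraholomorphic function on $N^{2n}$.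
   Context: An almost paracontact paracomplex Riemannian manifold $(M,\phi,\xi,\eta,g)$ is a smooth manifold of dimension $2n+1$ with a $(1,1)$-tensor field $\phi$, a vector field $\xi$, a 1-form $\eta$ satisfying $\phi^2=\mathrm{id}-\eta\otimes\xi$, $\eta(\xi)=1$, such that on $H=\ker\eta$ the eigenvalues $+1$ and $-1$ of $\phi|_H$ both have multiplicity $n$, and a Riemannian metric $g$ with $g(x,\xi)=\eta(x)$ and $g(\phi x,\phi y)=g(x,y)-\eta(x)\eta(y)$. With $\nabla$ the Levi-Civita connection of $g$ and $F(x,y,z)=g((\nabla_x\phi)y,z)$, it is called para-Sasaki-like if for all horizontal $X,Y,Z\in H$: $F(X,Y,Z)=F(\xi,Y,Z)=F(\xi,\xi,Z)=0$ and $F(X,Y,\xi)=-g(X,Y)$. The transformed structure $(\phi,\overline\xi,\overline\eta,\overline g)$ is again almost paracontact paracomplex Riemannian, and para-Sasaki-like for it means the same condition with $\overline\xi,\overline\eta,\overline g$ and the Levi-Civita connection of $\overline g$. On a para-Sasaki-like manifold $d\eta=0$, so locally $\eta=dt$ and $M=\mathbb R\times N^{2n}$ with $TN^{2n}=H$; $N^{2n}$ carries the paracomplex structure $P=\phi|_H$. A function $u+e\,v$ ($u,v$ real-valued, $e^2=1$) on $(N^{2n},P)$ is paraholomorphic if $du=dv\circ P$ and $du\circ P=dv$. *)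

(* Defs.v *)
From mathcomp Require Import all_boot all_order all_algebra.
From mathcomp Require Import all_classical all_reals all_analysis.
Import Order.TTheory GRing.Theory Num.Theory.
Import numFieldNormedType.Exports.

Set Implicit Arguments.
Unset Strict Implicit.
Unset Printing Implicit Defensive.

Local Open Scope classical_set_scope.
Local Open Scope ring_scope.

(* C^infinity on an open set U: every iterated directional derivative exists
   and is (Frechet) differentiable at every point of U. *)
Definition smooth_on (R : realType) (V W : normedModType R) (U : set V)
    (f : V -> W) : Prop :=
  forall (s : seq V) (x : V), U x ->
    differentiable (foldr (fun (v : V) (h : V -> W) => fun y : V => 'D_v h y) f s) x.

(* A chart c is a homeomorphism of the open set [dom c] onto the open set
   [img c], with inverse [param c]; the values of [coord c] and [param c]
   outside of these sets are irrelevant. *)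
Record manifold (R : realType) (m : nat) := Manifold {
  carrier :> topologicalType;
  chart : Type;
  dom : chart -> set carrier;
  img : chart -> set 'rV[R]_m;
  coord : chart -> carrier -> 'rV[R]_m;
  param : chart -> 'rV[R]_m -> carrier;
  manifold_hausdorff : hausdorff_space carrier;
  manifold_second_countable : @second_countable carrier;
  open_dom : forall c, open (dom c);
  open_img : forall c, open (img c);
  coord_img : forall c p, dom c p -> img c (coord c p);
  param_dom : forall c q, img c q -> dom c (param c q);
  coordK : forall c p, dom c p -> param c (coord c p) = p;
  paramK : forall c q, img c q -> coord c (param c q) = q;
  coord_continuous : forall c p, dom c p -> {for p, continuous (coord c)};
  param_continuous : forall c q, img c q -> {for q, continuous (param c)};
  dom_cover : forall p : carrier, exists c, dom c p;
  transition_smooth : forall c c',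
    smooth_on (img c `&` [set q | dom c' (param c q)])
              (fun q => coord c' (param c q))
}.

Section Tensors.
Variables (R : realType) (m : nat) (M : manifold R m).

Definition overlap (c c' : chart M) : set 'rV[R]_m :=
  img c `&` [set q | dom c' (param c q)].

Definition transition (c c' : chart M) (q : 'rV[R]_m) : 'rV[R]_m :=
  coord c' (param c q).

Definition smooth_fun (f : M -> R) : Prop :=
  forall c : chart M, smooth_on (img c) (fun q => f (param c q)).

(* The value of df on the tangent vector with components x, at the point with
   coordinates q in the chart c. *)
Definition dfun (f : M -> R) (c : chart M) (q x : 'rV[R]_m) : R :=
  'D_x (fun q' => f (param c q')) q.

(* Tensor fields are given by their components in all charts, as functions of
   the coordinates.  The components of a tangent vector form a row vector x.
   A 1-form eta acts by x *m eta, a (1,1)-tensor phi by x *m phi, and a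
   (0,2)-tensor G by x *m G *m y^T; the predicates below state smoothness and
   the transformation law under a change of chart. *)
Definition vector_comps := chart M -> 'rV[R]_m -> 'rV[R]_m.
Definition form_comps := chart M -> 'rV[R]_m -> 'cV[R]_m.
Definition endo_comps := chart M -> 'rV[R]_m -> 'M[R]_m.
Definition bilin_comps := chart M -> 'rV[R]_m -> 'M[R]_m.

Definition ev (e : 'cV[R]_m) (x : 'rV[R]_m) : R := (x *m e) 0 0.
Definition bil (G : 'M[R]_m) (x y : 'rV[R]_m) : R := (x *m G *m y^T) 0 0.

Definition vector_field (X : vector_comps) : Prop :=
  (forall c, smooth_on (img c) (X c)) /\
  (forall c c' q, overlap c c' q ->
     X c' (transition c c' q) = 'D_(X c q) (transition c c') q).

Definition one_form (eta : form_comps) : Prop :=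
  (forall c, smooth_on (img c) (eta c)) /\
  (forall c c' q, overlap c c' q -> forall x,
     ev (eta c q) x
     = ev (eta c' (transition c c' q)) ('D_x (transition c c') q)).

Definition endo_field (phi : endo_comps) : Prop :=
  (forall c, smooth_on (img c) (phi c)) /\
  (forall c c' q, overlap c c' q -> forall x,
     'D_(x *m phi c q) (transition c c') q
     = 'D_x (transition c c') q *m phi c' (transition c c' q)).

Definition riemannian_metric (g : bilin_comps) : Prop :=
  [/\ forall c, smooth_on (img c) (g c),
      forall c c' q, overlap c c' q -> forall x y,
        bil (g c q) x y
        = bil (g c' (transition c c' q)) ('D_x (transition c c') q)
                                         ('D_y (transition c c') q),
      forall c q, img c q -> forall x y, bil (g c q) x y = bil (g c q) y x
    & forall c q, img c q -> forall x, x != 0 -> 0 < bil (g c q) x x].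

(* An affine connection is given in each chart by its coefficients
   Gamma^k_(i j) = Gamma c q k i j. *)
Definition conn_comps := chart M -> 'rV[R]_m -> 'I_m -> 'M[R]_m.

(* (nabla_x Y)(q) = D_x Y (q) + Gamma(x, Y(q)), for a vector field Y given by
   its components in the chart c. *)
Definition nabla (Gamma : conn_comps) (c : chart M) (q x : 'rV[R]_m)
    (Y : 'rV[R]_m -> 'rV[R]_m) : 'rV[R]_m :=
  'D_x Y q + \row_k bil (Gamma c q k) x (Y q).

(* Torsion-free and metric, tested on the vector fields with constant
   components x, y, z in the chart c, whose Lie brackets vanish.  These
   identities determine Gamma on [img c], so that the transformation law of
   connection coefficients need not be required separately. *)
Definition levi_civita (g : bilin_comps) (Gamma : conn_comps) : Prop :=
  forall c q, img c q ->
    (forall x y : 'rV[R]_m,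
       nabla Gamma c q x (fun=> y) = nabla Gamma c q y (fun=> x)) /\
    (forall x y z : 'rV[R]_m,
       'D_x (fun q' => bil (g c q') y z) q
       = bil (g c q) (nabla Gamma c q x (fun=> y)) z
         + bil (g c q) y (nabla Gamma c q x (fun=> z))).

(* F(x,y,z) = g(nabla_x (phi Y) - phi (nabla_x Y), z), where Y is the field
   with constant components y in the chart c. *)
Definition F_tensor (Gamma : conn_comps) (phi : endo_comps) (g : bilin_comps)
    (c : chart M) (q x y z : 'rV[R]_m) : R :=
  bil (g c q) (nabla Gamma c q x (fun q' => y *m phi c q')
               - nabla Gamma c q x (fun=> y) *m phi c q) z.

(* Gamma stands for the Levi-Civita connection of g. *)
Definition para_sasaki_like (phi : endo_comps) (xi : vector_comps)
    (eta : form_comps) (g : bilin_comps) (Gamma : conn_comps) : Prop :=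
  forall c q, img c q -> forall x y z : 'rV[R]_m,
    ev (eta c q) x = 0 -> ev (eta c q) y = 0 -> ev (eta c q) z = 0 ->
    [/\ F_tensor Gamma phi g c q x y z = 0,
        F_tensor Gamma phi g c q (xi c q) y z = 0,
        F_tensor Gamma phi g c q (xi c q) (xi c q) z = 0
      & F_tensor Gamma phi g c q x y (xi c q) = - bil (g c q) x y].

Definition coshR (x : R) : R := (expR x + expR (- x)) / 2.
Definition sinhR (x : R) : R := (expR x - expR (- x)) / 2.

Definition conf_eta (w : M -> R) (eta : form_comps) : form_comps :=
  fun c q => expR (w (param c q)) *: eta c q.

Definition conf_xi (w : M -> R) (xi : vector_comps) : vector_comps :=
  fun c q => expR (- w (param c q)) *: xi c q.

(* See conf_gE below for the bilinear form of this matrix. *)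
Definition conf_g (u v w : M -> R) (phi : endo_comps) (eta : form_comps)
    (g : bilin_comps) : bilin_comps :=
  fun c q => let p := param c q in
    (expR (2 * u p) * coshR (2 * v p)) *: g c q
    + (expR (2 * u p) * sinhR (2 * v p)) *: (g c q *m (phi c q)^T)
    + (expR (2 * w p) - expR (2 * u p) * coshR (2 * v p))
        *: (eta c q *m (eta c q)^T).

Lemma conf_gE u v w phi eta g c q x y : let p := param c q in
  bil (conf_g u v w phi eta g c q) x y
  = expR (2 * u p) * coshR (2 * v p) * bil (g c q) x y
    + expR (2 * u p) * sinhR (2 * v p) * bil (g c q) x (y *m phi c q)
    + (expR (2 * w p) - expR (2 * u p) * coshR (2 * v p))
      * (ev (eta c q) x * ev (eta c q) y).
Proof.
have hlin (a b d : R) (A B C : 'M[R]_1) :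
    (a *: A + b *: B + d *: C) 0 0 = a * A 0 0 + b * B 0 0 + d * C 0 0.
  by rewrite !mxE.
have hphi : x *m (g c q *m (phi c q)^T) *m y^T
    = x *m g c q *m (y *m phi c q)^T by rewrite trmx_mul !mulmxA.
have heta : (x *m (eta c q *m (eta c q)^T) *m y^T) 0 0
    = (x *m eta c q) 0 0 * (y *m eta c q) 0 0.
  rewrite mulmxA -(mulmxA (x *m _)) -trmx_mul.
  by rewrite mxE big_ord1 [(_ ^T) 0 0]mxE.
rewrite /conf_g /bil /ev /= !mulmxDr !mulmxDl -!scalemxAr -!scalemxAl hphi.
by rewrite hlin heta.
Qed.

End Tensors.

Section ParacontactStructures.
Variables (R : realType) (n : nat) (M : manifold R (2 * n).+1).

Definition almost_paracontact_paracomplex_riemannian (phi : endo_comps M)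
    (xi : vector_comps M) (eta : form_comps M) (g : bilin_comps M) : Prop :=
  [/\ endo_field phi, vector_field xi, one_form eta, riemannian_metric g
    & forall c q, img c q ->
      [/\ forall x, x *m phi c q *m phi c q = x - ev (eta c q) x *: xi c q,
          ev (eta c q) (xi c q) = 1,
          \rank (kermx (eta c q) :&: eigenspace (phi c q) 1) = n
            /\ \rank (kermx (eta c q) :&: eigenspace (phi c q) (- 1)) = n,
          forall x, bil (g c q) x (xi c q) = ev (eta c q) x
        & forall x y, bil (g c q) (x *m phi c q) (y *m phi c q)
            = bil (g c q) x y - ev (eta c q) x * ev (eta c q) y]].

Variable N : manifold R (2 * n).

(* Psi identifies ]a, b[ x N with an open subset of M in such a way that
   d/dt = xi and TN = H = ker eta (so that eta = dt there, and the differential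
   of Psi is everywhere bijective), and P is the restriction of phi to H. *)
Definition local_product (phi : endo_comps M) (xi : vector_comps M)
    (eta : form_comps M) (a b : R) (Psi : R -> N -> M) (P : endo_comps N)
    : Prop :=
  [/\ a < b,
      [/\ forall t y, a < t < b ->
            {for (t, y), continuous (fun z : R * N => Psi z.1 z.2)},
          forall t t' y y', a < t < b -> a < t' < b ->
            Psi t y = Psi t' y' -> t = t' /\ y = y'
        & open [set p | exists t y, a < t < b /\ Psi t y = p]],
      forall (c : chart M) (k : chart N),
        smooth_on [set z : R * 'rV[R]_(2 * n) |
                    [/\ a < z.1 < b, img k z.2
                      & dom c (Psi z.1 (param k z.2))]]
                  (fun z => coord c (Psi z.1 (param k z.2))),
      endo_field P
    & forall (c : chart M) (k : chart N) (t : R) (y : 'rV[R]_(2 * n)),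
        a < t < b -> img k y -> dom c (Psi t (param k y)) ->
        let q := coord c (Psi t (param k y)) in
        let dPsi (x : 'rV[R]_(2 * n)) :=
          'D_x (fun y' => coord c (Psi t (param k y'))) y in
        [/\ 'D_(1 : R) (fun t' => coord c (Psi t' (param k y))) t = xi c q,
            forall x', ev (eta c q) x' = 0 <-> exists x, dPsi x = x'
          & forall x, dPsi (x *m P k y) = dPsi x *m phi c q]].

End ParacontactStructures.

(* u + e v is paraholomorphic for P: du = dv o P and du o P = dv. *)
Definition paraholomorphic (R : realType) (m : nat) (N : manifold R m)
    (P : endo_comps N) (u v : N -> R) : Prop :=
  [/\ smooth_fun u, smooth_fun v
    & forall k y, img k y -> forall x,
        dfun u k y x = dfun v k y (x *m P k y)
        /\ dfun u k y (x *m P k y) = dfun v k y x].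

(* Main.v *)
Require Import Defs.
From mathcomp Require Import all_boot all_order all_algebra.
From mathcomp Require Import all_classical all_reals all_analysis.
From mathcomp Require Import ring lra.
Import Order.TTheory GRing.Theory Num.Theory.
Import numFieldNormedType.Exports.

Set Implicit Arguments.
Unset Strict Implicit.
Unset Printing Implicit Defensive.

Local Open Scope classical_set_scope.
Local Open Scope ring_scope.

(** Everything except the last assertion happens at one point of one chart.
Write J for phi, h for eta, D for the Levi-Civita connection of g, and
A = exp(2u) cosh(2v), B = exp(2u) sinh(2v), so that
    gbar = A g + B g(., J.) + (exp(2w) - A) h (x) h.

Differentiating the algebraic identities J xi = 0, g(xi, xi) = 1 and
g(Jy, z) = g(y, Jz) along D, the para-Sasaki-like condition yields
D_x xi = Jx and (D_x J) y = - g(x, y) xi for horizontal x, y, together with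
D_xi xi = 0 and (D_xi J) y = 0 [nabla_xi_phi, nabla_phi_horizontal,
nabla_xi_xi, nabla_xi_endo].  Therefore K(x, y, z) = (D_x gbar)(y, z) is an
explicit expression in the differentials of A, B and w [derive_conf_g].

The difference T of the connections of gbar and g is symmetric and satisfies
K(x, y, z) = gbar(T(x, y), z) + gbar(y, T(x, z)), so the Koszul formula
expresses the tensor Fbar of the transformed structure through K and D J
[F_conf_koszul].  Evaluated on horizontal x, y, z it gives, with
a = dA o J - dB and b = dB o J - dA,
    2 Fbar(x, y, z)   = a(y) g(x, z) + b(y) g(x, Jz) + a(z) g(x, y)
                        + b(z) g(x, Jy),
    Fbar(xi, y, z)    = 0,
    Fbar(xi, xi, z)   = exp(2w) dw(Jz),
    2 Fbar(x, y, xi)  = - (2A + dB(xi)) g(x, y) - (2B + dA(xi)) g(x, Jy).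
Since dA = 2 (A du + B dv) and dB = 2 (B du + A dv), the three equations on
u, v, w make these the values that the para-Sasaki-like condition demands.
Conversely, horizontal eigenvectors of J for both eigenvalues +1 and -1 exist
because n > 0; inserting them separates the g- and g(., J.)-parts, and the
invertibility of the matrix with rows (A, B), (B, A), whose determinant is
exp(4u), gives back the equations [conf_para_sasaki_at].

The values of du and dv on xi are the equations at x = xi.  When w = 0 they
say that u and v are constant along the curves t |-> Psi t y of a local
product, hence descend to N; the descended functions are smooth by the chain
rule of all orders [smooth_upto_comp], and the remaining two equations
restricted to ker eta = TN are the paraholomorphy of u + e v. *)

(** * Derivatives of matrix-valued functions *)

Section DirectionalDerivatives.
Variables (R : realType) (V : normedModType R).

Lemma derive_comp (V1 W : normedModType R) (f : V1 -> W) (h : V -> V1)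
    (x v : V) :
  differentiable h x -> differentiable f (h x) ->
  'D_v (f \o h) x = 'D_('D_v h x) f (h x).
Proof.
move=> dh df; rewrite deriveE; last exact: differentiable_comp.
by rewrite diff_comp //= !deriveE.
Qed.

Lemma derive_dirD (W : normedModType R) (f : V -> W) (x v1 v2 : V) :
  differentiable f x -> 'D_(v1 + v2) f x = 'D_v1 f x + 'D_v2 f x.
Proof. by move=> df; rewrite !deriveE // linearD. Qed.

Lemma derive_dirZ (W : normedModType R) (f : V -> W) (x v : V) (k : R) :
  differentiable f x -> 'D_(k *: v) f x = k *: 'D_v f x.
Proof. by move=> df; rewrite !deriveE // linearZ. Qed.

End DirectionalDerivatives.

Section DerivativesOfMatrices.
Variables (R : realType) (V : normedModType R).

Lemma derive_mulmx (m n p : nat) (A : V -> 'M[R]_(m, n))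
    (B : V -> 'M[R]_(n, p)) (x v : V) :
  derivable A x v -> derivable B x v ->
  derivable (fun y => A y *m B y) x v /\
  'D_v (fun y => A y *m B y) x = 'D_v A x *m B x + A x *m 'D_v B x.
Proof.
move=> dA dB; have hA := (derivable_mxP A x v).1 dA.
have hB := (derivable_mxP B x v).1 dB.
have hE i j : (fun y => (A y *m B y) i j)
    = \sum_k ((fun y => A y i k) * (fun y => B y k j)).
  by apply/funext => y; rewrite mxE fct_sumE.
have hAB i j k : derivable ((fun y => A y i k) * (fun y => B y k j)) x v.
  exact: derivableM.
have dAB : derivable (fun y => A y *m B y) x v.
  apply/derivable_mxP => i j; rewrite hE; exact: derivable_sum.
split=> //; rewrite (derive_mx dAB); apply/matrixP => i j.
rewrite mxE hE derive_sum // !mxE -big_split; apply: eq_bigr => k _.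
rewrite deriveM // (derive_mx dA) (derive_mx dB) !mxE.
by rewrite addrC [X in X + _]mulrC.
Qed.

Lemma derive_trmx (m n : nat) (A : V -> 'M[R]_(m, n)) (x v : V) :
  derivable A x v ->
  derivable (fun y => (A y)^T) x v /\ 'D_v (fun y => (A y)^T) x = ('D_v A x)^T.
Proof.
move=> dA; have hA := (derivable_mxP A x v).1 dA.
have dT : derivable (fun y => (A y)^T) x v.
  apply/derivable_mxP => i j.
  rewrite (_ : (fun y => _) = fun y => A y j i) //.
  by apply/funext => y; rewrite mxE.
split=> //; rewrite (derive_mx dT) (derive_mx dA); apply/matrixP => i j.
by rewrite !mxE; congr ('D_v _ x); apply/funext => y; rewrite mxE.
Qed.

Lemma derive_bil (m : nat) (G : V -> 'M[R]_m) (Y Z : V -> 'rV[R]_m) (x v : V) :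
  derivable G x v -> derivable Y x v -> derivable Z x v ->
  derivable (fun q => bil (G q) (Y q) (Z q)) x v /\
  'D_v (fun q => bil (G q) (Y q) (Z q)) x
  = bil ('D_v G x) (Y x) (Z x) + bil (G x) ('D_v Y x) (Z x)
    + bil (G x) (Y x) ('D_v Z x).
Proof.
move=> dG dY dZ; have [dYG hYG] := derive_mulmx dY dG.
have [dZT hZT] := derive_trmx dZ; have [dP hP] := derive_mulmx dYG dZT.
split; first by have := (derivable_mxP _ _ _).1 dP 0 0.
have := congr1 (fun A : 'M[R]_1 => A 0 0) hP.
rewrite (derive_mx dP) mxE hYG hZT mulmxDl !mxE => ->.
by rewrite /bil !mxE [in RHS](addrC (\sum_i _)).
Qed.

Lemma derive_ev (m : nat) (e : V -> 'cV[R]_m) (y : 'rV[R]_m) (x v : V) :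
  derivable e x v ->
  derivable (fun q => ev (e q) y) x v
  /\ 'D_v (fun q => ev (e q) y) x = ev ('D_v e x) y.
Proof.
move=> de; have [dP hP] := derive_mulmx (derivable_cst y x v) de.
split; first by have := (derivable_mxP _ _ _).1 dP 0 0.
have := congr1 (fun A : 'M[R]_1 => A 0 0) hP.
by rewrite (derive_mx dP) mxE derive_cst mul0mx add0r.
Qed.

Lemma derive_expR_comp (f : V -> R) (x v : V) :
  differentiable f x ->
  derivable (fun y => expR (f y)) x v /\
  'D_v (fun y => expR (f y)) x = expR (f x) * 'D_v f x.
Proof.
move=> df; have de : differentiable (@expR R) (f x).
  exact/derivable1_diffP/derivable_expR.
have dc : differentiable (fun y => expR (f y)) x.
  exact: (differentiable_comp df de).
split; first exact: diff_derivable.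
rewrite (_ : (fun y => _) = expR \o f) // derive_comp //.
set d := 'D_v f x.
have -> : 'D_d (@expR R) (f x) = 'D_(d *: (1 : R)) (@expR R) (f x).
  by congr ('D__ _ _); rewrite [RHS]mulr1.
rewrite derive_dirZ // (congr1 (@^~ (f x)) (derive_expR R)).
by rewrite [LHS]mulrC.
Qed.

End DerivativesOfMatrices.

(** * Linear algebra of a paracontact structure at a point *)

Section BilinearAlgebra.
Variables (R : realType) (m : nat).
Implicit Types (G : 'M[R]_m) (e : 'cV[R]_m) (x y z : 'rV[R]_m) (k : R).

Lemma bilDl G x y z : bil G (x + y) z = bil G x z + bil G y z.
Proof. by rewrite /bil !mulmxDl mxE. Qed.
Lemma bilDr G x y z : bil G x (y + z) = bil G x y + bil G x z.
Proof. by rewrite /bil linearD mulmxDr mxE. Qed.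
Lemma bilZl G k x y : bil G (k *: x) y = k * bil G x y.
Proof. by rewrite /bil -!scalemxAl mxE. Qed.
Lemma bilZr G k x y : bil G x (k *: y) = k * bil G x y.
Proof. by rewrite /bil linearZ -scalemxAr mxE. Qed.
Lemma bil0l G x : bil G 0 x = 0.
Proof. by rewrite /bil !mul0mx mxE. Qed.
Lemma bil0r G x : bil G x 0 = 0.
Proof. by rewrite /bil trmx0 mulmx0 mxE. Qed.
Lemma bilNl G x y : bil G (- x) y = - bil G x y.
Proof. by rewrite -scaleN1r bilZl mulN1r. Qed.
Lemma bilNr G x y : bil G x (- y) = - bil G x y.
Proof. by rewrite -scaleN1r bilZr mulN1r. Qed.

Lemma ev0 e : ev e 0 = 0.
Proof. by rewrite /ev mul0mx mxE. Qed.
Lemma evD e x y : ev e (x + y) = ev e x + ev e y.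
Proof. by rewrite /ev mulmxDl mxE. Qed.
Lemma evZ e k x : ev e (k *: x) = k * ev e x.
Proof. by rewrite /ev -scalemxAl mxE. Qed.
Lemma evN e x : ev e (- x) = - ev e x.
Proof. by rewrite -scaleN1r evZ mulN1r. Qed.
Lemma ev_scale e k x : ev (k *: e) x = k * ev e x.
Proof. by rewrite /ev -scalemxAr mxE. Qed.

End BilinearAlgebra.

Section ParacontactAlgebra.
Variables (R : realType) (m n : nat).
Variables (G phi : 'M[R]_m) (xi : 'rV[R]_m) (eta : 'cV[R]_m).
Hypotheses (Gsym : forall x y, bil G x y = bil G y x)
  (Gpos : forall x, x != 0 -> 0 < bil G x x)
  (phiK : forall x, x *m phi *m phi = x - ev eta x *: xi)
  (eta_xi : ev eta xi = 1)
  (G_xi : forall x, bil G x xi = ev eta x)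
  (G_phi : forall x y,
     bil G (x *m phi) (y *m phi) = bil G x y - ev eta x * ev eta y).

Lemma bil_nondegenerate x : (forall z, bil G x z = 0) -> x = 0.
Proof.
by move=> h; apply/eqP/negP => /negP /Gpos; rewrite h ltxx.
Qed.

Lemma phi_xi : xi *m phi = 0.
Proof.
apply/eqP/negP => /negP /Gpos.
by rewrite G_phi G_xi eta_xi mulr1 subrr ltxx.
Qed.

(** Compute the cube of phi in two ways: the vertical part of phi x is killed
by both, so it vanishes. *)
Lemma eta_phi x : ev eta (x *m phi) = 0.
Proof.
have h : x *m phi *m phi *m phi = x *m phi.
  by rewrite (phiK x) mulmxBl -scalemxAl phi_xi scaler0 subr0.
have : ev eta (x *m phi) *: xi = 0.
  have := phiK (x *m phi); rewrite h -[LHS]addr0 => /addrI /eqP.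
  by rewrite eq_sym oppr_eq0 => /eqP.
by move=> /(congr1 (ev eta)); rewrite evZ eta_xi mulr1 ev0.
Qed.

Lemma phi_self_adjoint x y : bil G (x *m phi) y = bil G x (y *m phi).
Proof.
have := G_phi (x *m phi) y.
rewrite eta_phi mul0r subr0 => <-.
rewrite phiK bilDl bilNl bilZl Gsym [bil G xi _]Gsym G_xi eta_phi.
by rewrite mulr0 subr0 Gsym.
Qed.

(** Test vectors for the converse implication: they turn identities between
the forms g and g(., phi .) into numerical equations. *)
Lemma horizontal_eigenvector (e : R) :
  (0 < \rank (kermx eta :&: eigenspace phi e)%MS)%N ->
  exists y, [/\ ev eta y = 0, y *m phi = e *: y & 0 < bil G y y].
Proof.
rewrite lt0n mxrank_eq0 => /rowV0Pn [y]; rewrite sub_capmx => /andP[].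
move=> /sub_kermxP hy /eigenspaceP hphi y0; exists y; split=> //.
  by rewrite /ev hy mxE.
exact: Gpos.
Qed.

End ParacontactAlgebra.

(** * Metric connections in a chart *)

Section Connections.
Variables (R : realType) (m : nat) (M : manifold R m).
Variables (Gamma : conn_comps M) (phi : endo_comps M) (g : bilin_comps M).
Variables (c : chart M) (q : 'rV[R]_m).
Implicit Types (x y z : 'rV[R]_m) (Y Z : 'rV[R]_m -> 'rV[R]_m).

(** The covariant derivative of the constant field y in the direction x; it
is tensorial here because the chart is fixed. *)
Definition christoffel x y : 'rV[R]_m := nabla Gamma c q x (fun=> y).

(** The tensor (nabla_x phi) y, so that F(x, y, z) = g((nabla_x phi) y, z). *)
Definition nabla_endo x y : 'rV[R]_m :=
  nabla Gamma c q x (fun q' => y *m phi c q') - christoffel x y *m phi c q.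

Lemma nablaE x Y : nabla Gamma c q x Y = 'D_x Y q + christoffel x (Y q).
Proof. by rewrite /christoffel /nabla derive_cst add0r. Qed.

Lemma christoffelZ x (k : R) y : christoffel x (k *: y) = k *: christoffel x y.
Proof.
rewrite /christoffel /nabla !derive_cst !add0r.
by apply/rowP => i; rewrite !mxE bilZr.
Qed.

Lemma christoffel0 x : christoffel x 0 = 0.
Proof. by rewrite -[in LHS](scale0r (0 : 'rV[R]_m)) christoffelZ scale0r. Qed.

Hypotheses (dphi : differentiable (phi c) q) (dg : differentiable (g c) q).

Lemma nabla_mul_endo x Y : derivable Y q x ->
  nabla Gamma c q x (fun q' => Y q' *m phi c q')
  = nabla Gamma c q x Y *m phi c q + nabla_endo x (Y q).
Proof.
move=> dY; have dp := diff_derivable (v := x) dphi.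
have [_ h] := derive_mulmx dY dp.
have [_ h'] := derive_mulmx (derivable_cst (Y q) q x) dp.
rewrite /nabla_endo !nablaE h h' derive_cst mul0mx add0r mulmxDl.
by rewrite -!addrA; congr (_ + _); rewrite [RHS]addrC -!addrA addNr addr0.
Qed.

Lemma nabla_endoE x y :
  nabla_endo x y = y *m 'D_x (phi c) q + christoffel x (y *m phi c q)
                   - christoffel x y *m phi c q.
Proof.
have [_ h] := derive_mulmx (derivable_cst y q x)
                (diff_derivable (v := x) dphi).
by rewrite /nabla_endo nablaE h derive_cst mul0mx add0r.
Qed.

Lemma nabla_endoZl x y (k : R) : nabla_endo (k *: x) y = k *: nabla_endo x y.
Proof.
have cZ z : christoffel (k *: x) z = k *: christoffel x z.
  rewrite /christoffel /nabla !derive_cst !add0r.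
  by apply/rowP => i; rewrite !mxE bilZl.
by rewrite !nabla_endoE !cZ derive_dirZ // -scalemxAr -scalemxAl -scalerDr
  -scalerBr.
Qed.

Lemma nabla_endoZr x y (k : R) : nabla_endo x (k *: y) = k *: nabla_endo x y.
Proof.
by rewrite !nabla_endoE -!scalemxAl !christoffelZ -scalemxAl -scalerDr
  -scalerBr.
Qed.

(** Compatibility with the metric is assumed for constant fields only; the
product rule extends it to arbitrary ones. *)
Lemma derive_metric x Y Z : img c q -> levi_civita g Gamma ->
  derivable Y q x -> derivable Z q x ->
  'D_x (fun q' => bil (g c q') (Y q') (Z q')) q
  = bil (g c q) (nabla Gamma c q x Y) (Z q)
    + bil (g c q) (Y q) (nabla Gamma c q x Z).
Proof.
move=> hq hG dY dZ; have dgx := diff_derivable (v := x) dg.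
rewrite (nablaE x Y) (nablaE x Z) bilDl bilDr.
have [_ ->] := derive_bil dgx dY dZ.
have [_ /(_ x (Y q) (Z q))] := hG c q hq.
have [_ ->] := derive_bil dgx (derivable_cst (Y q) q x)
                 (derivable_cst (Z q) q x).
rewrite !derive_cst bil0l bil0r !addr0 => ->.
by rewrite /christoffel; ring.
Qed.

Lemma christoffel_sym x y : img c q -> levi_civita g Gamma ->
  christoffel x y = christoffel y x.
Proof. by move=> hq hG; have [h _] := hG c q hq; exact: h. Qed.

End Connections.

(** * Structure equations of a para-Sasaki-like manifold *)

Section StructureEquations.
Variables (R : realType) (n : nat) (M : manifold R (2 * n).+1).
Variables (phi : endo_comps M) (xi : vector_comps M)
  (eta : form_comps M) (g : bilin_comps M) (Gamma : conn_comps M).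
Hypotheses
  (hM : almost_paracontact_paracomplex_riemannian phi xi eta g)
  (hGamma : levi_civita g Gamma).
Variables (c : chart M).

Lemma structure_at q : img c q ->
  [/\ (forall x y, bil (g c q) x y = bil (g c q) y x),
      (forall x, x != 0 -> 0 < bil (g c q) x x)
    & [/\ forall x, x *m phi c q *m phi c q = x - ev (eta c q) x *: xi c q,
          ev (eta c q) (xi c q) = 1,
          forall x, bil (g c q) x (xi c q) = ev (eta c q) x
        & forall x y, bil (g c q) (x *m phi c q) (y *m phi c q)
            = bil (g c q) x y - ev (eta c q) x * ev (eta c q) y]].
Proof.
move=> hq; case: hM => _ _ _ [_ _ gs gp] /(_ c q hq) [h1 h2 _ h3 h4].
by split=> //; [exact: gs | exact: gp].
Qed.

Lemma structure_differentiable q : img c q ->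
  [/\ differentiable (phi c) q, differentiable (xi c) q,
      differentiable (eta c) q & differentiable (g c) q].
Proof.
move=> hq; case: hM => -[h1 _] [h2 _] [h3 _] [h4 _ _ _] _.
by split; [exact: (h1 c [::]) | exact: (h2 c [::]) | exact: (h3 c [::])
          | exact: (h4 c [::])].
Qed.

(** The images of charts are open, so identities between fields may be
differentiated. *)
Lemma derive_on_img (W : normedModType R) (f h : 'rV[R]_(2 * n).+1 -> W) q x :
  img c q -> (forall q', img c q' -> f q' = h q') -> 'D_x f q = 'D_x h q.
Proof.
move=> hq hfh; apply: near_eq_derive; near=> q'; apply: hfh; near: q'.
by apply: open_nbhs_nbhs; split=> //; exact: open_img.
Unshelve. all: by end_near. Qed.

Variable q : 'rV[R]_(2 * n).+1.
Hypothesis hq : img c q.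
Implicit Types x y z : 'rV[R]_(2 * n).+1.

Local Notation G := (bil (g c q)).
Local Notation J x := (x *m phi c q).
Local Notation X := (xi c q).
Local Notation h := (ev (eta c q)).
Local Notation Dphi := (nabla_endo Gamma phi c q).
Local Notation Dxi x := (nabla Gamma c q x (xi c)).

Lemma metric_sym x y : G x y = G y x.
Proof. by case: (structure_at hq). Qed.
Lemma metric_phi_adjoint q' x y : img c q' -> bil (g c q') (x *m phi c q') y
  = bil (g c q') x (y *m phi c q').
Proof.
move=> hq'; case: (structure_at hq') => ? ? [? ? ? ?].
exact: phi_self_adjoint.
Qed.
Lemma field_phi_xi q' : img c q' -> xi c q' *m phi c q' = 0.
Proof.
by move=> hq'; case: (structure_at hq') => ? ? [? ? ? ?]; apply: phi_xi; eauto.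
Qed.
Lemma field_eta_phi x : h (J x) = 0.
Proof.
by case: (structure_at hq) => ? ? [? ? ? ?]; apply: eta_phi; eauto.
Qed.
Lemma field_eta_xi : h X = 1.
Proof. by case: (structure_at hq) => ? ? []. Qed.
Lemma metric_xir x : G x X = h x.
Proof. by case: (structure_at hq) => ? ? []. Qed.
Lemma metric_xil x : G X x = h x.
Proof. by rewrite metric_sym metric_xir. Qed.
Lemma phiK_horizontal x : h x = 0 -> J (J x) = x.
Proof.
move=> hx; case: (structure_at hq) => ? ? [-> ? ? ?].
by rewrite hx scale0r subr0.
Qed.
(** By nondegeneracy, a vector is determined by its vertical component and
its products with horizontal vectors. *)
Lemma horizontal_ext y y' : (forall z, h z = 0 -> G y z = G y' z) ->
  h y = h y' -> y = y'.
Proof.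
move=> hz hy; apply/subr0_eq.
case: (structure_at hq) => ? Gp [? ? ? ?]; apply: (bil_nondegenerate Gp) => z.
have hh : h (z - h z *: X) = 0 by rewrite evD evN evZ field_eta_xi mulr1 subrr.
have e t : G t z = G t (z - h z *: X) + h z * h t.
  by rewrite -(metric_xir t) -bilZr -bilDr subrK.
by rewrite bilDl bilNl !e (hz _ hh) hy subrr.
Qed.

(** Derivative of g(phi y, z) = g(y, phi z). *)
Lemma nabla_phi_self_adjoint x y z : G (Dphi x y) z = G y (Dphi x z).
Proof.
have [dp dX de dg] := structure_differentiable hq.
have dy (y0 : 'rV[R]_(2 * n).+1) : derivable (fun q' => y0 *m phi c q') q x.
  by have [] := derive_mulmx (derivable_cst y0 q x)
                  (diff_derivable (v := x) dp).
have := derive_on_img x hq (fun q' hq' => metric_phi_adjoint y z hq').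
rewrite (derive_metric dg hq hGamma (dy y) (derivable_cst z q x)).
rewrite (derive_metric dg hq hGamma (derivable_cst y q x) (dy z)).
rewrite !(nabla_mul_endo _ dp (derivable_cst _ q x)) /cst.
rewrite -!/(christoffel Gamma c q x _).
move: (christoffel _ _ _ x y) (christoffel _ _ _ x z) => Gy Gz.
by rewrite bilDl bilDr !metric_phi_adjoint //; lra.
Qed.

(** Derivative of g(xi, xi) = 1. *)
Lemma nabla_xi_horizontal x : h (Dxi x) = 0.
Proof.
have [dp dX de dg] := structure_differentiable hq.
have dX' := diff_derivable (v := x) dX.
have hc q' : img c q' -> bil (g c q') (xi c q') (xi c q') = 1.
  by move=> hq'; case: (structure_at hq') => _ _ [_ h1 -> _].
have := derive_on_img (h := cst (1 : R)) x hq hc.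
rewrite derive_cst (derive_metric dg hq hGamma dX' dX') metric_xir metric_xil.
by lra.
Qed.

(** Derivative of phi xi = 0. *)
Lemma nabla_phi_xi x : Dphi x X = - J (Dxi x).
Proof.
have [dp dX de dg] := structure_differentiable hq.
have dX' := diff_derivable (v := x) dX.
have := nabla_mul_endo Gamma dp dX'.
rewrite nablaE field_phi_xi //.
rewrite (derive_on_img (h := cst (0 : 'rV[R]_(2 * n).+1)) x hq
           (fun q' hq' => field_phi_xi hq')).
rewrite derive_cst add0r christoffel0 => /eqP.
by rewrite eq_sym addrC addr_eq0 => /eqP.
Qed.

(** Derivative of eta(y) = g(y, xi). *)
Lemma derive_eta x y :
  'D_x (fun q' => ev (eta c q') y) q
  = h (christoffel Gamma c q x y) + G y (Dxi x).
Proof.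
have [dp dX de dg] := structure_differentiable hq.
have dX' := diff_derivable (v := x) dX.
have hc q' : img c q' -> ev (eta c q') y = bil (g c q') y (xi c q').
  by move=> hq'; case: (structure_at hq') => _ _ [_ _ -> _].
rewrite (derive_on_img x hq hc).
by rewrite (derive_metric dg hq hGamma (derivable_cst y q x) dX') metric_xir.
Qed.

Hypothesis hPSL : para_sasaki_like phi xi eta g Gamma.

Lemma nabla_xi_xi : Dxi X = 0.
Proof.
apply: horizontal_ext => [z hz|]; last by rewrite nabla_xi_horizontal ev0.
have hz' := field_eta_phi z; have [_ _ h3 _] := hPSL hq hz' hz' hz'.
move: h3; rewrite /F_tensor -/(nabla_endo _ _ _ _ _ _) nabla_phi_xi bilNl.
rewrite bil0l metric_phi_adjoint // phiK_horizontal // => /eqP.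
by rewrite oppr_eq0 => /eqP.
Qed.

(** The condition F(x, y, xi) = - g(x, y) determines nabla xi: moving nabla phi
across the metric and using phi xi = 0, it reads
g(nabla_x xi, z) = g(phi x, z) for y = phi z. *)
Lemma nabla_xi_phi x : h x = 0 -> Dxi x = J x.
Proof.
move=> hx; apply: horizontal_ext => [z hz|].
  2: by rewrite nabla_xi_horizontal field_eta_phi.
have [_ _ _] := hPSL hq hx (field_eta_phi z) (field_eta_phi z).
rewrite /F_tensor -/(nabla_endo _ _ _ _ _ _) nabla_phi_self_adjoint.
rewrite nabla_phi_xi bilNr metric_sym metric_phi_adjoint //.
rewrite phiK_horizontal // metric_phi_adjoint //.
by move=> /oppr_inj.
Qed.

Lemma nabla_phi_horizontal x y : h x = 0 -> h y = 0 ->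
  Dphi x y = - G x y *: X.
Proof.
move=> hx hy; apply: horizontal_ext => [z hz|].
  have [h1 _ _ _] := hPSL hq hx hy hz.
  by rewrite bilZl metric_xil hz mulr0 -h1.
have [_ _ _ h4] := hPSL hq hx hy hy.
by rewrite -metric_xir evZ field_eta_xi mulr1 -h4.
Qed.

(** The horizontal component is F(xi, y, z); the vertical one vanishes because
g((nabla_xi phi) y, xi) = g(y, (nabla_xi phi) xi) and nabla_xi xi = 0. *)
Lemma nabla_xi_endo y : h y = 0 -> Dphi X y = 0.
Proof.
move=> hy; apply: horizontal_ext => [z hz|].
  have [_ h2 _ _] := hPSL hq hy hy hz.
  by rewrite bil0l -h2.
rewrite -metric_xir nabla_phi_self_adjoint nabla_phi_xi nabla_xi_xi.
by rewrite mul0mx oppr0 bil0r ev0.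
Qed.

End StructureEquations.

(** * The conformal factors and their differentials *)

Section HyperbolicFunctions.
Variables (R : realType) (V : normedModType R).

Lemma derive_coshR_comp (f : V -> R) (x v : V) : differentiable f x ->
  derivable (fun y => coshR (f y)) x v /\
  'D_v (fun y => coshR (f y)) x = sinhR (f x) * 'D_v f x.
Proof.
move=> df; have [d1 e1] := derive_expR_comp v df.
have [d2 e2] := derive_expR_comp v (differentiableN df).
have d3 := derivableD d1 d2.
have E : (fun y => coshR (f y))
    = 2^-1 *: ((fun y => expR (f y)) + (fun y => expR ((- f) y))).
  by apply/funext => y; rewrite /coshR mulrC.
rewrite E; split; first exact: derivableZ.
rewrite (deriveZ _ d3) (deriveD d1 d2) e1 e2 (deriveN (diff_derivable df)).
by rewrite /sinhR /GRing.scale /=; field.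
Qed.

Lemma derive_sinhR_comp (f : V -> R) (x v : V) : differentiable f x ->
  derivable (fun y => sinhR (f y)) x v /\
  'D_v (fun y => sinhR (f y)) x = coshR (f x) * 'D_v f x.
Proof.
move=> df; have [d1 e1] := derive_expR_comp v df.
have [d2 e2] := derive_expR_comp v (differentiableN df).
have d3 := derivableB d1 d2.
have E : (fun y => sinhR (f y))
    = 2^-1 *: ((fun y => expR (f y)) - (fun y => expR ((- f) y))).
  by apply/funext => y; rewrite /sinhR mulrC.
rewrite E; split; first exact: derivableZ.
rewrite (deriveZ _ d3) (deriveB d1 d2) e1 e2 (deriveN (diff_derivable df)).
by rewrite /coshR /GRing.scale /=; field.
Qed.

Lemma coshR2_sinhR2 (x : R) : coshR x ^+ 2 - sinhR x ^+ 2 = 1.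
Proof.
rewrite /coshR /sinhR expRN; have := expR_gt0 x; move: (expR x) => e e0.
by field; rewrite gt_eqF.
Qed.

End HyperbolicFunctions.

Section ConformalFactors.
Variables (R : realType) (m : nat) (M : manifold R m).
Variables (u v : M -> R) (c : chart M).
Implicit Types q x : 'rV[R]_m.

Definition conf_cosh q : R :=
  expR (2 * u (param c q)) * coshR (2 * v (param c q)).
Definition conf_sinh q : R :=
  expR (2 * u (param c q)) * sinhR (2 * v (param c q)).

(** The difference of squares is exp(4u); it is the determinant of the matrix
with rows (A, B) and (B, A) that turns (2 du, 2 dv) into (dA, dB). *)
Lemma conf_cosh2_sinh2_gt0 q : 0 < conf_cosh q ^+ 2 - conf_sinh q ^+ 2.
Proof.
rewrite /conf_cosh /conf_sinh [(_ * coshR _) ^+ 2]exprMn.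
rewrite [(_ * sinhR _) ^+ 2]exprMn -mulrBr coshR2_sinhR2 mulr1.
by rewrite exprn_gt0 // expR_gt0.
Qed.

Lemma differentiable_double (f : M -> R) q :
  differentiable (fun q' => f (param c q')) q ->
  differentiable (fun q' => 2 * f (param c q')) q.
Proof. by move=> df; exact: (differentiableZ 2 df). Qed.

Lemma derive_double (f : M -> R) q x :
  differentiable (fun q' => f (param c q')) q ->
  'D_x (fun q' => 2 * f (param c q')) q = 2 * dfun f c q x.
Proof.
move=> df; have := diff_derivable (v := x) df => dv.
exact: (deriveZ 2 dv).
Qed.

Lemma derive_conf_cosh q x :
  differentiable (fun q' => u (param c q')) q ->
  differentiable (fun q' => v (param c q')) q ->
  derivable conf_cosh q x /\
  'D_x conf_cosh q
  = 2 * (conf_cosh q * dfun u c q x + conf_sinh q * dfun v c q x).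
Proof.
move=> du dv; have [d1 e1] := derive_expR_comp x (differentiable_double du).
have [d2 e2] := derive_coshR_comp x (differentiable_double dv).
split; first exact: (derivableM d1 d2).
rewrite (deriveM d1 d2) e1 e2 !derive_double // /conf_cosh /conf_sinh.
by rewrite /GRing.scale /=; ring.
Qed.

Lemma derive_conf_sinh q x :
  differentiable (fun q' => u (param c q')) q ->
  differentiable (fun q' => v (param c q')) q ->
  derivable conf_sinh q x /\
  'D_x conf_sinh q
  = 2 * (conf_sinh q * dfun u c q x + conf_cosh q * dfun v c q x).
Proof.
move=> du dv; have [d1 e1] := derive_expR_comp x (differentiable_double du).
have [d2 e2] := derive_sinhR_comp x (differentiable_double dv).
split; first exact: (derivableM d1 d2).
rewrite (deriveM d1 d2) e1 e2 !derive_double // /conf_cosh /conf_sinh.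
by rewrite /GRing.scale /=; ring.
Qed.

End ConformalFactors.

(** * The tensor F of the transformed structure *)

Section ConformalChange.
Variables (R : realType) (n : nat) (M : manifold R (2 * n).+1).
Variables (phi : endo_comps M) (xi : vector_comps M)
  (eta : form_comps M) (g : bilin_comps M) (Gamma : conn_comps M).
Variables (u v w : M -> R) (Gammabar : conn_comps M).
Hypotheses
  (hM : almost_paracontact_paracomplex_riemannian phi xi eta g)
  (hGamma : levi_civita g Gamma)
  (hu : smooth_fun u) (hv : smooth_fun v) (hw : smooth_fun w)
  (hGammabar : levi_civita (conf_g u v w phi eta g) Gammabar).
Variables (c : chart M) (q : 'rV[R]_(2 * n).+1).
Hypothesis hq : img c q.
Implicit Types x y z : 'rV[R]_(2 * n).+1.

Local Notation G := (bil (g c q)).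
Local Notation Gb := (bil (conf_g u v w phi eta g c q)).
Local Notation J x := (x *m phi c q).
Local Notation X := (xi c q).
Local Notation h := (ev (eta c q)).
Local Notation Dphi := (nabla_endo Gamma phi c q).
Local Notation Dxi x := (nabla Gamma c q x (xi c)).
Local Notation A := (conf_cosh u v c q).
Local Notation B := (conf_sinh u v c q).
Local Notation E2w := (expR (2 * w (param c q))).
Local Notation du := (dfun u c q).
Local Notation dv := (dfun v c q).
Local Notation dw := (dfun w c q).
Local Notation Fbar := (F_tensor Gammabar phi (conf_g u v w phi eta g) c q).

(** Closed forms of the differentials of A and B; see [derive_conf_cosh] and
[derive_conf_sinh]. *)
Local Definition dA x := 2 * (A * du x + B * dv x).
Local Definition dB x := 2 * (B * du x + A * dv x).

(** The covariant derivative (nabla_x gbar)(y, z) with respect to the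
connection of the original metric g. *)
Definition nabla_conf_g x y z : R :=
  dA x * G y z + dB x * G y (J z) + B * G y (Dphi x z)
  + (2 * E2w * dw x - dA x) * (h y * h z)
  + (E2w - A) * (G y (Dxi x) * h z + h y * G z (Dxi x)).

Local Notation K := nabla_conf_g.

Lemma chart_differentiable (f : M -> R) : smooth_fun f ->
  differentiable (fun q' => f (param c q')) q.
Proof. by move=> /(_ c [::] q hq). Qed.

Lemma conf_bilE x y :
  Gb x y = A * G x y + B * G x (J y) + (E2w - A) * (h x * h y).
Proof. exact: conf_gE. Qed.

Lemma derive_conf_g x y z :
  'D_x (fun q' => bil (conf_g u v w phi eta g c q') y z) q
  = Gb (christoffel Gamma c q x y) z + Gb y (christoffel Gamma c q x z)
    + K x y z.
Proof.
have [dp dX de dg] := structure_differentiable hM hq.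
have [dA' eA] := derive_conf_cosh x (chart_differentiable hu)
                  (chart_differentiable hv).
have [dB' eB] := derive_conf_sinh x (chart_differentiable hu)
                  (chart_differentiable hv).
have dw' := chart_differentiable hw.
have [dC' eC] := derive_expR_comp x (differentiable_double dw').
have dy := derivable_cst y q x; have dz := derivable_cst z q x.
have [dJz _] := derive_mulmx dz (diff_derivable (v := x) dp).
have dg' := diff_derivable (v := x) dg.
have [d1 _] := derive_bil dg' dy dz; have [d2 _] := derive_bil dg' dy dJz.
have [d3 _] := derive_ev y (diff_derivable (v := x) de).
have [d4 _] := derive_ev z (diff_derivable (v := x) de).
have d5 := derivableB dC' dA'.
have d34 := derivableM d3 d4.
have -> : (fun q' => bil (conf_g u v w phi eta g c q') y z)
  = conf_cosh u v c * (fun q' => bil (g c q') y z)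
    + conf_sinh u v c * (fun q' => bil (g c q') y (z *m phi c q'))
    + ((fun q' => expR (2 * w (param c q'))) - conf_cosh u v c)
      * ((fun q' => ev (eta c q') y) * (fun q' => ev (eta c q') z)).
  by apply/funext => q'; rewrite conf_gE.
have t1 := derivableM dA' d1; have t2 := derivableM dB' d2.
have t3 := derivableM d5 d34.
rewrite (deriveD (derivableD t1 t2) t3) (deriveD t1 t2).
rewrite (deriveM dA' d1) (deriveM dB' d2) (deriveM d5 d34) (deriveM d3 d4).
rewrite (deriveB dC' dA') eA eB eC (derive_double _ dw').
rewrite !(derive_eta hM hGamma hq).
rewrite (derive_metric dg hq hGamma dy dz) (derive_metric dg hq hGamma dy dJz).
rewrite (nabla_mul_endo Gamma dp dz) -!/(christoffel _ _ _ _ _) /cst !conf_bilE.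
rewrite /K /dA /dB.
move: (christoffel _ _ _ x y) (christoffel _ _ _ x z) => Gy Gz.
rewrite bilDr !fctE /GRing.scale /=; ring.
Qed.

Local Notation T x y :=
  (christoffel Gammabar c q x y - christoffel Gamma c q x y).

(** The connection of gbar is metric, so only its difference with the
connection of g contributes to nabla gbar. *)
Lemma nabla_conf_gE x y z : K x y z = Gb (T x y) z + Gb y (T x z).
Proof.
have [_ /(_ x y z)] := hGammabar hq.
rewrite derive_conf_g -!/(christoffel Gammabar c q x _).
move: (christoffel Gamma _ _ x y) (christoffel Gamma _ _ x z) => Gy Gz.
move: (christoffel Gammabar _ _ x y) (christoffel Gammabar _ _ x z) => Hy Hz.
by rewrite bilDl bilDr bilNl bilNr; lra.
Qed.

Lemma conf_g_sym x y : Gb x y = Gb y x.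
Proof.
rewrite !conf_bilE (metric_sym hM hq x y) -(metric_phi_adjoint hM x y hq).
by rewrite (metric_sym hM hq (J x)) [h x * _]mulrC.
Qed.

Lemma conf_g_phi_adjoint x y : Gb (J x) y = Gb x (J y).
Proof.
rewrite !conf_bilE !(field_eta_phi hM hq) !(mul0r, mulr0).
by rewrite !(metric_phi_adjoint hM _ _ hq).
Qed.

(** Koszul formula for the symmetric difference T of the two connections,
applied to (nablabar_x phi) y = (nabla_x phi) y + T(x, phi y) - phi T(x, y),
where phi is moved to the other side of gbar. *)
Lemma F_conf_koszul x y z :
  2 * Fbar x y z
  = 2 * Gb (Dphi x y) z
    + (K x (J y) z + K (J y) x z - K z x (J y))
    - (K x y (J z) + K y x (J z) - K (J z) x y).
Proof.
have [dp dX de dg] := structure_differentiable hM hq.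
have Tsym x' y' : T x' y' = T y' x'.
  by rewrite (christoffel_sym _ _ hq hGamma) (christoffel_sym _ _ hq hGammabar).
have hE : Fbar x y z
    = Gb (Dphi x y + T x (J y) - J (T x y)) z.
  have dy := derivable_cst y q x.
  rewrite /F_tensor -/(christoffel Gammabar c q x y) /nabla_endo !nablaE.
  rewrite mulmxBl; congr (bil _ _ z).
  have vec (a b k d e : 'rV[R]_(2 * n).+1) :
      a + b - e = a + k - d + (b - k) - (e - d).
    by apply/rowP => i; rewrite !mxE; ring.
  exact: vec.
rewrite hE !nabla_conf_gE bilDl bilDl bilNl conf_g_phi_adjoint.
rewrite (Tsym (J y) x) (Tsym (J z) x) (Tsym (J z) y) (Tsym z x) (Tsym z (J y)).
rewrite (Tsym y x) (conf_g_sym x) (conf_g_sym _ (J y)) (conf_g_sym y).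
by rewrite (conf_g_sym x (T y (J z))); lra.
Qed.

Lemma nabla_conf_g_sym x y z : K x y z = K x z y.
Proof. by rewrite !nabla_conf_gE addrC (conf_g_sym y) (conf_g_sym z). Qed.

Lemma nabla_conf_g0l y z : K 0 y z = 0.
Proof.
have T0 y' : T 0 y' = 0.
  rewrite (christoffel_sym _ _ hq hGamma) (christoffel_sym _ _ hq hGammabar).
  by rewrite !christoffel0 subr0.
by rewrite nabla_conf_gE !T0 bil0l bil0r addr0.
Qed.

Lemma nabla_conf_g0r x y : K x y 0 = 0.
Proof. by rewrite nabla_conf_gE !christoffel0 subrr !bil0r addr0. Qed.

Hypothesis hPSL : para_sasaki_like phi xi eta g Gamma.

Let Gxr := metric_xir hM hq.
Let Gxl := metric_xil hM hq.
Let hJ := field_eta_phi hM hq.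
Let JJ := phiK_horizontal hM hq.
Let hX := field_eta_xi hM hq.
Let Js x y : G (J x) y = G x (J y) := metric_phi_adjoint hM x y hq.

(** In the next five names the letters h and x tell whether the corresponding
argument is horizontal or the vector xi. *)
Lemma nabla_conf_g_hhh x y z : h x = 0 -> h y = 0 -> h z = 0 ->
  K x y z = dA x * G y z + dB x * G y (J z).
Proof.
move=> hx hy hz; rewrite /K (nabla_phi_horizontal hM hq hPSL hx hz).
by rewrite bilZr Gxr hy hz; ring.
Qed.

Lemma nabla_conf_g_xhh y z : h y = 0 -> h z = 0 ->
  K X y z = dA X * G y z + dB X * G y (J z).
Proof.
move=> hy hz; rewrite /K (nabla_xi_endo hM hGamma hq hPSL hz).
by rewrite bil0r hy hz; ring.
Qed.

Lemma nabla_conf_g_hxh x z : h x = 0 -> h z = 0 ->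
  K x X z = - B * G x z + (E2w - A) * G x (J z).
Proof.
move=> hx hz; rewrite /K (nabla_phi_horizontal hM hq hPSL hx hz).
rewrite (nabla_xi_phi hM hGamma hq hPSL hx) bilZr Gxr !Gxl !hJ hX hz.
by rewrite (metric_sym hM hq z) Js; ring.
Qed.

Lemma nabla_conf_g_xxh z : h z = 0 -> K X X z = 0.
Proof.
move=> hz; rewrite /K (nabla_xi_endo hM hGamma hq hPSL hz).
rewrite (nabla_xi_xi hM hGamma hq hPSL) !bil0r !Gxl hJ hX hz.
by ring.
Qed.

Lemma nabla_conf_g_hxx x : h x = 0 -> K x X X = 2 * E2w * dw x.
Proof.
move=> hx; rewrite /K (nabla_phi_xi Gamma hM hq).
rewrite (nabla_xi_phi hM hGamma hq hPSL hx) bilNr !Gxl !hJ hX.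
by ring.
Qed.

(** The terms with dA(x) and dB(x) cancel because phi is self-adjoint for g. *)
Lemma F_conf_horizontal x y z : h x = 0 -> h y = 0 -> h z = 0 ->
  2 * Fbar x y z
  = (dA (J y) - dB y) * G x z + (dB (J y) - dA y) * G x (J z)
    + (dA (J z) - dB z) * G x y + (dB (J z) - dA z) * G x (J y).
Proof.
move=> hx hy hz; rewrite F_conf_koszul (nabla_phi_horizontal hM hq hPSL hx hy).
rewrite !nabla_conf_g_hhh ?hJ // !JJ // conf_bilE !bilZl !Gxl evZ !hJ hX hz.
rewrite !Js !JJ //.
by move: dA dB (bil (g c q)) => a b G0; ring.
Qed.

(** The dA(xi) and dB(xi) terms cancel because phi is self-adjoint for g; the
four remaining derivatives of gbar are equal, and two
of them enter the Koszul formula with each sign. *)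
Lemma F_conf_xi y z : h y = 0 -> h z = 0 ->
  Fbar X y z = 0.
Proof.
move=> hy hz; apply: (@mulfI _ 2); first by rewrite pnatr_eq0.
rewrite mulr0 F_conf_koszul (nabla_xi_endo hM hGamma hq hPSL hy) bil0l.
rewrite !nabla_conf_g_xhh ?hJ //.
rewrite !nabla_conf_g_hxh ?hJ // !Js !JJ //.
rewrite (metric_sym hM hq z y) (metric_sym hM hq z (J y)) Js.
by ring.
Qed.

Lemma F_conf_xi_xi z : h z = 0 ->
  Fbar X X z = E2w * dw (J z).
Proof.
move=> hz; apply: (@mulfI _ 2); first by rewrite pnatr_eq0.
rewrite F_conf_koszul (nabla_phi_xi Gamma hM hq).
rewrite (nabla_xi_xi hM hGamma hq hPSL).
rewrite (field_phi_xi hM hq) mul0mx oppr0 bil0l (nabla_conf_g_sym X 0).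
rewrite !nabla_conf_g0r nabla_conf_g0l nabla_conf_g_xxh ?hJ //.
by rewrite nabla_conf_g_hxx ?hJ //; ring.
Qed.

Lemma F_conf_horizontal_xi x y : h x = 0 -> h y = 0 ->
  2 * Fbar x y X
  = - (2 * A + dB X) * G x y - (2 * B + dA X) * G x (J y).
Proof.
move=> hx hy; rewrite F_conf_koszul (nabla_phi_horizontal hM hq hPSL hx hy).
rewrite (field_phi_xi hM hq) !nabla_conf_g0r nabla_conf_g0l.
rewrite !(nabla_conf_g_sym _ _ X) !nabla_conf_g_hxh ?hJ //.
rewrite nabla_conf_g_xhh ?hJ // !JJ // conf_bilE !bilZl !Gxl evZ !hJ hX.
rewrite !Js !JJ // (metric_sym hM hq y x) (metric_sym hM hq y (J x)) Js.
by ring.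
Qed.

Lemma dfunD (f : M -> R) x y : smooth_fun f ->
  dfun f c q (x + y) = dfun f c q x + dfun f c q y.
Proof. by move=> hf; exact: (derive_dirD x y (chart_differentiable hf)). Qed.

Lemma dfunZ (f : M -> R) (k : R) x : smooth_fun f ->
  dfun f c q (k *: x) = k * dfun f c q x.
Proof. by move=> hf; exact: (derive_dirZ x k (chart_differentiable hf)). Qed.

Lemma dfunN (f : M -> R) x : smooth_fun f ->
  dfun f c q (- x) = - dfun f c q x.
Proof. by move=> hf; rewrite -scaleN1r dfunZ // mulN1r. Qed.

Lemma F_tensor_xiZl (k : R) y z :
  Fbar (k *: X) y z = k * Fbar X y z.
Proof.
have [dp _ _ _] := structure_differentiable hM hq.
by rewrite /F_tensor -!/(nabla_endo _ _ _ _ _ _) nabla_endoZl // bilZl.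
Qed.

Lemma F_tensor_xiZm x (k : R) z :
  Fbar x (k *: X) z = k * Fbar x X z.
Proof.
have [dp _ _ _] := structure_differentiable hM hq.
by rewrite /F_tensor -!/(nabla_endo _ _ _ _ _ _) nabla_endoZr // bilZl.
Qed.

(** A - B and A + B are the eigenvalues of the matrix that turns (2 du, 2 dv)
into (dA, dB). *)
Lemma factors_neq0 : A - B != 0 /\ A + B != 0.
Proof.
have := conf_cosh2_sinh2_gt0 u v c q; rewrite subr_sqr => AB.
by split; apply/eqP => e; move: AB; rewrite e ?mul0r ?mulr0 ltxx.
Qed.

(** If x and y are eigenvectors for opposite eigenvalues -s and s, they are
orthogonal, and 2 Fbar(x, y, x) reduces to
4 (s A - B) (du(y) - s dv(y)) g(x, x). *)
Lemma dfun_eigenvector (s : R) x y : s = 1 \/ s = -1 ->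
  h x = 0 -> J x = - s *: x -> 0 < G x x -> h y = 0 -> J y = s *: y ->
  Fbar x y x = 0 -> du y = s * dv y.
Proof.
move=> hs hx Jx Gx hy Jy hF; have [AB1 AB2] := factors_neq0.
have Gxy : G x y = 0.
  by have := Js x y; rewrite Jx Jy bilZl bilZr; case: hs => ->; lra.
have := F_conf_horizontal hx hy hx.
rewrite hF Jx Jy Gxy !bilZr Gxy /dA /dB !dfunZ //.
have sAB : s * A - B != 0.
  case: hs => ->; first by rewrite mul1r.
  by rewrite mulN1r -opprD oppr_eq0.
clear hF Jx Jy hx hy AB1 AB2 Gxy.
move: sAB Gx; move: A B (du y) (dv y) (G x x) (du x) (dv x).
move=> a b k l N k' l' sAB N0 e; apply/eqP; rewrite -subr_eq0.
apply/eqP; apply: (mulfI sAB); apply: (mulIf (lt0r_neq0 N0)); move: e.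
by clear sAB N0; case: hs => ->; lra.
Qed.

(** Split y into the eigenvectors y + phi y and y - phi y (up to a factor 2),
and test each against an eigenvector of the opposite eigenvalue. *)
Lemma dfun_horizontal ep en :
  h ep = 0 -> h en = 0 -> J ep = ep -> J en = - en ->
  0 < G ep ep -> 0 < G en en ->
  (forall x y z, h x = 0 -> h y = 0 -> h z = 0 -> Fbar x y z = 0) ->
  forall y, h y = 0 -> du y = dv (J y) /\ du (J y) = dv y.
Proof.
move=> hp hn Jp Jn Gp Gn hF y hy.
have hyp : h (y + J y) = 0 by rewrite evD hJ hy addr0.
have hyn : h (y - J y) = 0 by rewrite evD evN hJ hy subr0.
have : du (y + J y) = 1 * dv (y + J y).
  apply: (dfun_eigenvector _ hn) => //; first by left.
  - by rewrite scaleN1r.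
  - by rewrite scale1r mulmxDl JJ // addrC.
  - exact: hF.
have : du (y - J y) = -1 * dv (y - J y).
  apply: (dfun_eigenvector _ hp) => //; first by right.
  - by rewrite opprK scale1r.
  - by rewrite scaleN1r mulmxBl JJ // opprB.
  - exact: hF.
rewrite !dfunD // !dfunN //.
move: (du y) (dv y) (du (J y)) (dv (J y)) => a b a' b' e1 e2.
lra.
Qed.

(** On an eigenvector of phi both sides are multiples of g(x, x), with factors
(A + B) (1 + dv(xi) + du(xi)) and (A - B) (1 + dv(xi) - du(xi)) on the left
and exp(w) (A + B) and exp(w) (A - B) on the right, up to sign. *)
Lemma dfun_xi ep en :
  h ep = 0 -> h en = 0 -> J ep = ep -> J en = - en ->
  0 < G ep ep -> 0 < G en en ->
  (forall x y, h x = 0 -> h y = 0 ->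
     Fbar x y X = - (expR (w (param c q)) * Gb x y)) ->
  du X = 0 /\ dv X = expR (w (param c q)) - 1.
Proof.
move=> hp hn Jp Jn Gp Gn hF; have [AB1 AB2] := factors_neq0.
have e1 := F_conf_horizontal_xi hp hp.
have e2 := F_conf_horizontal_xi hn hn.
rewrite hF // conf_bilE Jp hp /dA /dB in e1.
rewrite hF // conf_bilE Jn hn bilNr /dA /dB in e2.
set e := expR (w _) in e1 e2 *.
have e3 : (A + B) * (1 + dv X + du X - e) = 0.
  by apply: (mulIf (lt0r_neq0 Gp)); move: e1; lra.
have e4 : (A - B) * (1 + dv X - du X - e) = 0.
  by apply: (mulIf (lt0r_neq0 Gn)); move: e2; lra.
move/eqP: e3; rewrite mulf_eq0 (negPf AB2) /= => /eqP.
move/eqP: e4; rewrite mulf_eq0 (negPf AB1) /= => /eqP.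
lra.
Qed.

(** The equivalence at one point.  The conditions on horizontal vectors and on
xi are combined by decomposing x = (x - eta(x) xi) + eta(x) xi. *)
Lemma conf_para_sasaki_at : (0 < n)%N ->
  (forall x y z, h x = 0 -> h y = 0 -> h z = 0 ->
    [/\ Fbar x y z = 0, Fbar (conf_xi w xi c q) y z = 0,
        Fbar (conf_xi w xi c q) (conf_xi w xi c q) z = 0
      & Fbar x y (conf_xi w xi c q) = - Gb x y])
  <-> (forall x, [/\ dw (J x) = 0, du x - dv (J x) = 0
        & du (J x) - dv x = (1 - expR (w (param c q))) * h x]).
Proof.
move=> n0; have xiE : conf_xi w xi c q = expR (- w (param c q)) *: X by [].
have ew : expR (- w (param c q)) * expR (w (param c q)) = 1.
  by rewrite mulrC expRxMexpNx_1.
have ew0 : expR (- w (param c q)) != 0 by rewrite gt_eqF ?expR_gt0.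
rewrite xiE; split=> [hF x|hD x y z hx hy hz].
  have [_ _ _ _ /(_ c q hq) [_ _ [rp rn] _ _]] := hM.
  have [gs gp _] := structure_at hM hq.
  have [ep [hp Jp Gp]] : exists y, [/\ h y = 0, J y = 1 *: y & 0 < G y y].
    by apply: (horizontal_eigenvector gp); rewrite rp.
  have [en [hn Jn Gn]] : exists y, [/\ h y = 0, J y = -1 *: y & 0 < G y y].
    by apply: (horizontal_eigenvector gp); rewrite rn.
  rewrite scale1r in Jp; rewrite scaleN1r in Jn.
  have hh := dfun_horizontal hp hn Jp Jn Gp Gn
    (fun x y z hx hy hz => let: And4 a _ _ _ := hF x y z hx hy hz in a).
  have [duX dvX] : du X = 0 /\ dv X = expR (w (param c q)) - 1.
    apply: (dfun_xi hp hn Jp Jn Gp Gn) => x' y' hx' hy'.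
    have [_ _ _] := hF x' y' y' hx' hy' hy'.
    rewrite /F_tensor bilZr => e.
    by rewrite -mulrN -e mulrCA mulrA ew mul1r.
  set y := x - h x *: X.
  have hy : h y = 0 by rewrite evD evN evZ hX mulr1 subrr.
  have Jy : J y = J x.
    by rewrite mulmxBl -scalemxAl (field_phi_xi hM hq) scaler0 subr0.
  have xE : x = y + h x *: X by rewrite subrK.
  have [e1 e2] := hh y hy; split.
  - have [_ _ + _] := hF y y y hy hy hy.
    rewrite F_tensor_xiZl F_tensor_xiZm F_conf_xi_xi // => /eqP.
    by rewrite !mulf_eq0 (negPf ew0) gt_eqF ?expR_gt0 //= Jy => /eqP.
  - by rewrite [in du x]xE dfunD // dfunZ // duX e1 Jy; ring.
  - by rewrite -Jy e2 [in dv x]xE dfunD // dfunZ // dvX; ring.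
have hD1 y' : h y' = 0 -> dv (J y') = du y' /\ du (J y') = dv y'.
  by move=> hy'; have [_] := hD y'; rewrite hy'; lra.
have dAB y' : h y' = 0 -> dA (J y') = dB y' /\ dB (J y') = dA y'.
  by move=> hy'; rewrite /dA /dB; have [-> ->] := hD1 y' hy'; split; ring.
split.
- apply: (@mulfI _ 2); first by rewrite pnatr_eq0.
  rewrite F_conf_horizontal //; have [-> ->] := dAB y hy.
  by have [-> ->] := dAB z hz; ring.
- by rewrite F_tensor_xiZl F_conf_xi // mulr0.
- rewrite F_tensor_xiZl F_tensor_xiZm F_conf_xi_xi //.
  by have [-> _ _] := hD z; rewrite !mulr0.
- have [_] := hD X; rewrite (field_phi_xi hM hq) hX mulr1.
  have d0 (f : M -> R) : dfun f c q 0 = 0 by rewrite /dfun derive0.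
  rewrite !d0 subr0 sub0r => duX /eqP; rewrite eqr_oppLR => /eqP dvX.
  have := F_conf_horizontal_xi hx hy; rewrite /dA /dB duX dvX => e.
  rewrite /F_tensor bilZr -/(F_tensor _ _ _ _ _ x y X).
  have -> : Fbar x y X = - (expR (w (param c q)) * Gb x y).
    by apply: (@mulfI _ 2); rewrite ?pnatr_eq0 // e conf_bilE hx; ring.
  by rewrite mulrN mulrA ew mul1r.
Qed.

End ConformalChange.

(** * Composition of smooth maps *)

Section SmoothCalculus.
Variable R : realType.

(** Differentiability is a local property: the first-order expansion of f at x
is also one of g. *)
Lemma near_eq_differentiable (V W : normedModType R) (f g : V -> W) (x : V) :
  (\near x, f x = g x) -> differentiable f x -> differentiable g x.
Proof.
move=> fg /diff_locallyP [dc /eqaddoP df]; have fgx := nbhs_singleton fg.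
have dg : g \o shift x = cst (g x) + 'd f x +o_ 0 id.
  apply/eqaddoP => e e0; near=> h.
  have <- : (f \o shift x - (cst (f x) + 'd f x)) h
          = (g \o shift x - (cst (g x) + 'd f x)) h.
    rewrite !fctE /= fgx; congr (_ - _).
    by near: h; move: fg; rewrite (near_shift 0) subr0.
  by near: h; exact: df.
by apply/diff_locallyP; rewrite (diff_unique dc dg).
Unshelve. all: by end_near. Qed.


(** Smoothness graded by the number of derivatives, so that closure properties
can be proved by induction: the derivative of a product or of a composite
involves the given functions themselves, at one order less. *)
Fixpoint smooth_upto (k : nat) (V W : normedModType R) (U : set V)
    (f : V -> W) : Prop :=
  (forall x, U x -> differentiable f x) /\
  if k is k'.+1 then forall v, smooth_upto k' U (fun x => 'D_v f x) else True.

Lemma smooth_upto_differentiable k (V W : normedModType R) (U : set V)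
    (f : V -> W) x :
  smooth_upto k U f -> U x -> differentiable f x.
Proof. by case: k => [|k] [h _]; exact: h. Qed.

Lemma smooth_on_upto (V W : normedModType R) (U : set V) (f : V -> W) :
  smooth_on U f <-> forall k, smooth_upto k U f.
Proof.
split=> [hf k|hf s x Ux].
  elim: k f hf => [|k IH] f hf; (split=> [x|]; first exact: (hf [::])) => // v.
  by apply: IH => s x Ux; have := hf (rcons s v) x Ux; rewrite foldr_rcons.
have {hf} := hf (size s); elim/last_ind: s f => [|s v IH] f.
  by move=> [h _]; exact: h.
by rewrite size_rcons foldr_rcons => -[_ h]; exact: (IH _ (h v)).
Qed.

Lemma smooth_upto_pred k (V W : normedModType R) (U : set V) (f : V -> W) :
  smooth_upto k.+1 U f -> smooth_upto k U f.
Proof.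
elim: k f => [|k IH] f [h1 h2]; first by [].
by split=> // v; apply: IH; exact: h2.
Qed.

Lemma smooth_upto_eq k (V W : normedModType R) (U : set V) (f g : V -> W) :
  open U -> (forall x, U x -> f x = g x) ->
  smooth_upto k U f -> smooth_upto k U g.
Proof.
move=> oU; have near_eq (f' g' : V -> W) x : (forall x, U x -> f' x = g' x) ->
    U x -> \near x, f' x = g' x.
  move=> fg Ux; near=> y; apply: fg; near: y.
  by apply: open_nbhs_nbhs.
elim: k f g => [|k IH] f g fg [h1 h2]; split=> //.
- by move=> x Ux; apply: near_eq_differentiable (h1 x Ux); exact: near_eq.
- by move=> x Ux; apply: near_eq_differentiable (h1 x Ux); exact: near_eq.
- move=> v; apply: IH (h2 v) => x Ux; apply: near_eq_derive; exact: near_eq.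
Unshelve. all: by end_near. Qed.

Lemma smooth_uptoD k (V W : normedModType R) (U : set V) (f g : V -> W) :
  open U -> smooth_upto k U f -> smooth_upto k U g ->
  smooth_upto k U (fun x => f x + g x).
Proof.
move=> oU; elim: k f g => [|k IH] f g [f1 f2] [g1 g2].
  by split=> // x Ux; exact: differentiableD (f1 x Ux) (g1 x Ux).
split=> [x Ux|v]; first exact: differentiableD (f1 x Ux) (g1 x Ux).
apply: (smooth_upto_eq oU _ (IH _ _ (f2 v) (g2 v))) => x Ux.
by rewrite (deriveD (diff_derivable (f1 x Ux)) (diff_derivable (g1 x Ux))).
Qed.

Lemma smooth_uptoM k (V : normedModType R) (U : set V) (f g : V -> R) :
  open U -> smooth_upto k U f -> smooth_upto k U g ->
  smooth_upto k U (fun x => f x * g x).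
Proof.
move=> oU; elim: k f g => [|k IH] f g hf hg.
  by split=> // x Ux; apply: differentiableM;
    [exact: (smooth_upto_differentiable hf Ux)
    |exact: (smooth_upto_differentiable hg Ux)].
have [[f1 f2] [g1 g2]] := (hf, hg).
split=> [x Ux|v]; first exact: differentiableM (f1 x Ux) (g1 x Ux).
have hfg := smooth_uptoD oU (IH _ _ (smooth_upto_pred hf) (g2 v))
                            (IH _ _ (smooth_upto_pred hg) (f2 v)).
apply: (smooth_upto_eq oU _ hfg) => x Ux.
by rewrite (deriveM (diff_derivable (f1 x Ux)) (diff_derivable (g1 x Ux))).
Qed.

Lemma smooth_upto_cst k (V W : normedModType R) (U : set V) (a : W) :
  smooth_upto k U (fun=> a).
Proof.
elim: k a => [|k IH] a; split=> // v.
have -> : (fun x : V => 'D_v (fun=> a) x) = fun=> 0.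
  by apply/funext => x; exact: derive_cst.
exact: IH.
Qed.

Lemma smooth_upto_sum k (V : normedModType R) (U : set V) (I : Type) (r : seq I)
    (f : I -> V -> R) :
  open U -> (forall i, smooth_upto k U (f i)) ->
  smooth_upto k U (fun x => \sum_(i <- r) f i x).
Proof.
move=> oU hf; elim: r => [|i r IH].
  apply: (smooth_upto_eq oU _ (smooth_upto_cst k U (0 : R))) => x _.
  by rewrite big_nil.
apply: (smooth_upto_eq oU _ (smooth_uptoD oU (hf i) IH)) => x _.
by rewrite big_cons.
Qed.

(** Taking a coordinate commutes with directional derivatives. *)
Lemma smooth_upto_coord k (V : normedModType R) (U : set V) (m : nat)
    (f : V -> 'rV[R]_m) (j : 'I_m) :
  open U -> smooth_upto k U f -> smooth_upto k U (fun x => f x 0 j : R).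
Proof.
move=> oU; have dj (f' : V -> 'rV[R]_m) x : differentiable f' x ->
    differentiable (fun x => f' x 0 j : R) x.
  by move=> df; exact: (differentiable_comp df (differentiable_coord _ _ _)).
elim: k f => [|k IH] f [f1 f2]; split=> //; [by move=> x /f1; exact: dj..|].
move=> v; apply: (smooth_upto_eq oU _ (IH _ (f2 v))) => x Ux.
by rewrite (derive_mx (diff_derivable (f1 x Ux))) mxE.
Qed.

(** The chain rule writes a derivative of f o h as the sum over j of
(D_v h)_j (D_(e_j) f) o h, whose terms are covered by induction. *)
Lemma smooth_upto_comp k (V : normedModType R) (m : nat) (U : set V)
    (W : set 'rV[R]_m) (h : V -> 'rV[R]_m) (f : 'rV[R]_m -> R) :
  open U -> (forall x, U x -> W (h x)) ->
  smooth_upto k U h -> smooth_upto k W f ->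
  smooth_upto k U (fun x => f (h x)).
Proof.
move=> oU UW; elim: k f => [|k IH] f hh hf.
  split=> // x Ux.
  apply: (differentiable_comp (smooth_upto_differentiable hh Ux)).
  exact: (smooth_upto_differentiable hf (UW _ Ux)).
have [[h1 h2] [f1 f2]] := (hh, hf).
split=> [x Ux|v].
  exact: (differentiable_comp (h1 _ Ux) (f1 _ (UW _ Ux))).
pose e j : 'rV[R]_m := delta_mx 0 j.
have smooth_term j : smooth_upto k U (fun x => 'D_v h x 0 j * 'D_(e j) f (h x)).
  apply: (smooth_uptoM oU (smooth_upto_coord j oU (h2 v))).
  by apply: (IH (fun z => 'D_(e j) f z)); [exact: smooth_upto_pred|exact: f2].
have hsum := smooth_upto_sum (index_enum 'I_m) oU smooth_term.
apply: (smooth_upto_eq oU _ hsum) => x Ux.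
rewrite (_ : (fun y => _) = f \o h) //.
rewrite (derive_comp _ (h1 _ Ux) (f1 _ (UW _ Ux))).
rewrite (deriveE _ (f1 _ (UW _ Ux))) [in RHS](row_sum_delta ('D_v h x)).
rewrite linear_sum; apply: eq_bigr => j _.
by rewrite linearZ (deriveE _ (f1 _ (UW _ Ux))).
Qed.

(** Derivatives of the slice along v are slices of derivatives along (0, v). *)
Lemma smooth_upto_slice k (V W : normedModType R) (D : set (R * V))
    (f : R * V -> W)
    (t : R) :
  smooth_upto k D f -> smooth_upto k [set y | D (t, y)] (fun y => f (t, y)).
Proof.
have dpair y : differentiable (fun y : V => (t, y)) y.
  by apply: differentiable_pair.
elim: k f => [|k IH] f [f1 f2]; split=> //.
- by move=> y Dy; exact: (differentiable_comp (dpair y) (f1 _ Dy)).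
- by move=> y Dy; exact: (differentiable_comp (dpair y) (f1 _ Dy)).
- move=> v; rewrite (_ : (fun y => _) = fun y => 'D_(0, v) f (t, y)).
    exact: (IH _ (f2 (0, v))).
  apply/funext => y; have E (h : R) : (t, h *: v + y) = h *: (0, v) + (t, y).
    by congr (_, _); rewrite /= scaler0 add0r.
  by rewrite /derive /=; under eq_fun do rewrite E.
Qed.

End SmoothCalculus.

(** * Functions on a local product *)

Section LocalProduct.
Variables (R : realType) (n : nat) (M : manifold R (2 * n).+1)
  (N : manifold R (2 * n)).
Variables (phi : endo_comps M) (xi : vector_comps M) (eta : form_comps M)
  (a b : R) (Psi : R -> N -> M) (P : endo_comps N).
Hypothesis hPsi : local_product phi xi eta a b Psi P.
Variable u : M -> R.
Hypothesis hu : smooth_fun u.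

Lemma continuous_slicel (y : 'rV[R]_(2 * n)) : continuous (fun t : R => (t, y)).
Proof.
by move=> t; apply: differentiable_continuous; exact: differentiable_pair.
Qed.

Lemma continuous_slicer (t : R) : continuous (fun y : 'rV[R]_(2 * n) => (t, y)).
Proof.
by move=> y; apply: differentiable_continuous; exact: differentiable_pair.
Qed.

Local Notation H c k := (fun z : R * 'rV[R]_(2 * n) =>
  Defs.coord c (Psi z.1 (param k z.2))).

Lemma local_product_chart_diff (c : chart M) (k : chart N) t y :
  a < t < b -> img k y -> dom c (Psi t (param k y)) ->
  differentiable (H c k) (t, y).
Proof.
by move=> tab ky cy; case: hPsi => _ _ /(_ c k [::]) hs _ _; exact: hs.
Qed.

Lemma local_product_near (c : chart M) (k : chart N) t y :
  a < t < b -> img k y -> dom c (Psi t (param k y)) ->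
  \forall z \near (t, y), dom c (Psi z.1 (param k z.2)).
Proof.
move=> tab ky cy; case: hPsi => _ [hcont _ _] _ _ _.
have kc := param_continuous ky.
have hc : (fun z : R * 'rV[R]_(2 * n) => Psi z.1 (param k z.2)) @ (t, y)
    --> Psi t (param k y).
  apply: (@continuous2_cvg _ R N M _ _ fst (fun z => param k z.2) Psi t).
  - exact: (hcont t (param k y) tab).
  - exact: cvg_fst.
  - by apply: (@cvg_comp _ _ _ snd (param k) _ (nbhs y)) => //; exact: cvg_snd.
apply: hc; apply: open_nbhs_nbhs; split=> //; exact: open_dom.
Qed.

(** The curve t |-> Psi t y has velocity xi. *)
Lemma derive_along_xi (k : chart N) t y : a < t < b -> img k y ->
  (forall c q, img c q -> dfun u c q (xi c q) = 0) ->
  is_derive t (1 : R) (fun t' => u (Psi t' (param k y))) 0.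
Proof.
move=> tab ky hxi; have [c cy] := dom_cover (Psi t (param k y)).
set q := Defs.coord c (Psi t (param k y)).
have cq : img c q by exact: coord_img.
have dq : differentiable (fun t' => Defs.coord c (Psi t' (param k y))) t.
  have dt : differentiable (fun t' : R => (t', y)) t.
    exact: differentiable_pair.
  exact: (differentiable_comp dt (local_product_chart_diff tab ky cy)).
have du : differentiable (fun q' => u (param c q')) q.
  exact: (chart_differentiable cq hu).
have near_t : \near t, u (param c (Defs.coord c (Psi t (param k y))))
                       = u (Psi t (param k y)).
  have hn := local_product_near tab ky cy.
  have hn' : \forall s \near t, dom c (Psi s (param k y)).
    exact: (@continuous_slicel y t _ hn).
  by apply: filterS hn' => s cs; rewrite coordK.
apply: (near_eq_is_derive near_t); apply: DeriveDef.
  by apply: diff_derivable; exact: (differentiable_comp dq du).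
rewrite (_ : (fun t' => _)
  = (fun q' => u (param c q'))
    \o (fun t' => Defs.coord c (Psi t' (param k y)))) //.
rewrite (derive_comp _ dq du); case: hPsi => _ _ _ _ /(_ c k t y tab ky cy).
by case=> -> _ _; exact: hxi.
Qed.

Lemma constant_along_xi t t' y : a < t < b -> a < t' < b ->
  (forall c q, img c q -> dfun u c q (xi c q) = 0) ->
  u (Psi t y) = u (Psi t' y).
Proof.
move=> + + hxi; have [k ky] := dom_cover y.
have yE := coordK ky; have kq := coord_img ky.
wlog tt' : t t' / t <= t'.
  by move=> W ht ht'; case: (leP t t') => [/W|/ltW /W] => [->|<-].
move=> /andP[at_ tb] /andP[at' tb'].
have hd s : t <= s <= t' ->
    is_derive s (1 : R) (fun t' => u (Psi t' (param k (Defs.coord k y)))) 0.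
  move=> /andP[ts st]; apply: derive_along_xi => //.
  by rewrite (lt_le_trans at_ ts) (le_lt_trans st tb').
pose f s := u (Psi s (param k (Defs.coord k y))).
have fd s : s \in `]t, t'[ -> is_derive s (1 : R) f 0.
  by move=> /itvP sI; apply: hd; rewrite !sI.
have fc : {within `[t, t'], continuous f}.
  apply: derivable_within_continuous => s; rewrite in_itv /= => sI.
  by have := hd s sI => -[].
have [s _] := MVT_segment tt' fd fc.
by rewrite mul0r /f yE => /eqP; rewrite subr_eq0 eq_sym => /eqP.
Qed.

(** Smoothness is checked near each point y, on the open set of those y' that
Psi t sends into a chosen chart c; there the function is the composite of u
in the chart c with the smooth coordinate expression of Psi. *)
Lemma slice_smooth t : a < t < b -> smooth_fun (fun y => u (Psi t y)).
Proof.
move=> tab k s y ky; have [c cy] := dom_cover (Psi t (param k y)).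
pose D := [set z : R * 'rV[R]_(2 * n) |
  [/\ a < z.1 < b, img k z.2 & dom c (Psi z.1 (param k z.2))]].
pose U := [set y' : 'rV[R]_(2 * n) | D (t, y')].
have oU : open U.
  rewrite openE => y' [_ ky' cy'].
  have hn := local_product_near tab ky' cy'.
  have hn' : \forall z \near y', dom c (Psi t (param k z)).
    exact: (@continuous_slicer t y' _ hn).
  have hk : nbhs y' (img k).
    by apply: open_nbhs_nbhs; split=> //; exact: open_img.
  by near=> z; split=> //=; near: z.
suff : smooth_on U (fun y' => u (Psi t (param k y'))) by apply; split.
apply/smooth_on_upto => j.
have hH : smooth_upto j U (fun y' => Defs.coord c (Psi t (param k y'))).
  apply: (smooth_upto_slice (f := H c k)).
  by case: hPsi => _ _ /(_ c k) /smooth_on_upto h _ _; exact: h.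
have hc : smooth_upto j (img c) (fun q => u (param c q)).
  by have /smooth_on_upto := @hu c.
apply: (smooth_upto_eq oU _ (smooth_upto_comp oU _ hH hc)).
- by move=> y' [_ _ cy']; rewrite /= coordK.
- by move=> y' [_ _ cy']; exact: coord_img.
Unshelve. all: by end_near. Qed.

Lemma dfun_slice (c : chart M) (k : chart N) t y x :
  a < t < b -> img k y -> dom c (Psi t (param k y)) ->
  dfun (fun y => u (Psi t y)) k y x
  = dfun u c (Defs.coord c (Psi t (param k y)))
      ('D_x (fun y' => Defs.coord c (Psi t (param k y'))) y).
Proof.
move=> tab ky cy; set q := Defs.coord c (Psi t (param k y)).
have cq : img c q by exact: coord_img.
have dq : differentiable (fun y' => Defs.coord c (Psi t (param k y'))) y.
  have dt : differentiable (fun y' : 'rV[R]_(2 * n) => (t, y')) y.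
    exact: differentiable_pair.
  exact: (differentiable_comp dt (local_product_chart_diff tab ky cy)).
have du : differentiable (fun q' => u (param c q')) q.
  exact: (chart_differentiable cq hu).
rewrite /dfun -(derive_comp _ dq du); apply: near_eq_derive.
have hn := local_product_near tab ky cy.
have hn' : \forall z \near y, dom c (Psi t (param k z)).
  exact: (@continuous_slicer t y _ hn).
by apply: filterS hn' => z cz; rewrite /= coordK.
Qed.

End LocalProduct.

Theorem proposition4p2 (R : realType) (n : nat) (hn : (0 < n)%N)
    (M : manifold R (2 * n).+1)
    (phi : endo_comps M) (xi : vector_comps M) (eta : form_comps M)
    (g : bilin_comps M) (Gamma : conn_comps M)
    (hM : almost_paracontact_paracomplex_riemannian phi xi eta g)
    (hGamma : levi_civita g Gamma)
    (hPSL : para_sasaki_like phi xi eta g Gamma)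
    (u v w : M -> R)
    (hu : smooth_fun u) (hv : smooth_fun v) (hw : smooth_fun w)
    (Gammabar : conn_comps M)
    (hGammabar : levi_civita (conf_g u v w phi eta g) Gammabar) :
  let PSLbar := para_sasaki_like phi (conf_xi w xi) (conf_eta w eta)
                  (conf_g u v w phi eta g) Gammabar in
  [/\ PSLbar <->
        (forall c q, img c q -> forall x,
           [/\ dfun w c q (x *m phi c q) = 0,
               dfun u c q x - dfun v c q (x *m phi c q) = 0
             & dfun u c q (x *m phi c q) - dfun v c q x
               = (1 - expR (w (param c q))) * ev (eta c q) x]),
      PSLbar -> forall c q, img c q ->
        dfun u c q (xi c q) = 0
        /\ dfun v c q (xi c q) = expR (w (param c q)) - 1
    & PSLbar -> (forall p, w p = 0) ->
        (forall c q, img c q ->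
           dfun u c q (xi c q) = 0 /\ dfun v c q (xi c q) = 0)
        /\ (forall (N : manifold R (2 * n)) (a b : R) (Psi : R -> N -> M)
              (P : endo_comps N), local_product phi xi eta a b Psi P ->
            exists uN vN : N -> R,
              (forall t y, a < t < b ->
                 u (Psi t y) = uN y /\ v (Psi t y) = vN y)
              /\ paraholomorphic P uN vN)].
Proof.
move=> PSLbar.
have hevbar c q x : ev (conf_eta w eta c q) x = 0 <-> ev (eta c q) x = 0.
  rewrite ev_scale; split=> [/eqP|->]; last by rewrite mulr0.
  by rewrite mulf_eq0 gt_eqF ?expR_gt0 //= => /eqP.
have main : PSLbar <-> (forall c q, img c q -> forall x,
    [/\ dfun w c q (x *m phi c q) = 0,
        dfun u c q x - dfun v c q (x *m phi c q) = 0
      & dfun u c q (x *m phi c q) - dfun v c q x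
        = (1 - expR (w (param c q))) * ev (eta c q) x]).
  split=> h c q hq.
    apply/(conf_para_sasaki_at hM hGamma hu hv hw hGammabar hq hPSL hn).
    by move=> x y z hx hy hz; apply: (h c q hq); exact/hevbar.
  move=> x y z /hevbar hx /hevbar hy /hevbar hz.
  have [_ hb] := conf_para_sasaki_at hM hGamma hu hv hw hGammabar hq hPSL hn.
  exact: (hb (h c q hq)).
have along_xi : PSLbar -> forall c q, img c q ->
    dfun u c q (xi c q) = 0
    /\ dfun v c q (xi c q) = expR (w (param c q)) - 1.
  move=> /main h c q hq; have [_] := h c q hq (xi c q).
  rewrite (field_phi_xi hM hq) (field_eta_xi hM hq) mulr1.
  by rewrite /dfun !derive0 subr0 sub0r => -> /eqP; rewrite eqr_oppLR opprB
    => /eqP.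
split=> // hbar w0.
have xi0 c q : img c q -> dfun u c q (xi c q) = 0 /\ dfun v c q (xi c q) = 0.
  by move=> hq; have [-> ->] := along_xi hbar c q hq; rewrite w0 expR0 subrr.
split=> // N a b Psi P hPsi.
have ab : a < b by case: hPsi.
pose t0 := (a + b) / 2; have t0ab : a < t0 < b.
  by rewrite midf_lt //= ?midf_lt.
exists (fun y => u (Psi t0 y)), (fun y => v (Psi t0 y)); split.
  move=> t y tab; split; apply: (constant_along_xi hPsi) => // c q hq;
    by case: (xi0 c q hq).
split; [exact: (slice_smooth hPsi hu)|exact: (slice_smooth hPsi hv)|].
move=> k y ky x; have [c cy] := dom_cover (Psi t0 (param k y)).
rewrite !(dfun_slice hPsi hu _ t0ab ky cy) !(dfun_slice hPsi hv _ t0ab ky cy).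
have [_ _ _ _ /(_ c k t0 y t0ab ky cy) /= [_ _ ->]] := hPsi.
have [_ e1] := main.1 hbar c _ (coord_img cy)
  ('D_x (fun y' => Defs.coord c (Psi t0 (param k y'))) y).
rewrite w0 expR0 subrr mul0r => e2.
by split; apply/eqP; rewrite -subr_eq0; apply/eqP.
Qed.
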